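(* There exists an integer $N$ such that for every integer $n\ge N$ there exists a set $A\subset\{1,2,\ldots,n\}$ such that $|A|\ge n/3$, $E(A)\ge\frac16|A|^3$, and $EI(A)\le 2000\,|A|^2(\log|A|)^2$.
   Context: For a finite set of integers $A=\{a_1<a_2<\cdots<a_m\}$ (listed in increasing order), the additive energy is $E(A)=|\{(i,j,k,l)\in\{1,\ldots,m\}^4: a_i+a_j=a_k+a_l\}|$, and the indexed energy is $EI(A)=|\{(i,j,k,l)\in\{1,\ldots,m\}^4: a_i+a_j=a_k+a_l \text{ and } i+j=k+l\}|$. Here $\log$ is the natural logarithm. *)

(* Defs.v *)
From HB Require Import structures.
From mathcomp Require Import all_boot all_order all_algebra.
From mathcomp Require Import finmap.
From mathcomp Require Import all_classical all_reals all_analysis.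

Set Implicit Arguments.
Unset Strict Implicit.
Unset Printing Implicit Defensive.

Import Order.TTheory GRing.Theory Num.Theory.

Local Open Scope ring_scope.

(* Indices run over 0, ..., m-1 instead of 1, ..., m, so [nth_elt A i] is
   a_(i+1). The condition i + j = k + l is invariant under this shift. *)
Definition nth_elt (A : {fset int}) (i : 'I_(#|` A|)) : int :=
  nth 0 (sort <=%R (enum_fset A)) i.

Definition additive_energy (A : {fset int}) : nat :=
  #|[set q : 'I_(#|` A|) * 'I_(#|` A|) * 'I_(#|` A|) * 'I_(#|` A|) |
      let: (i, j, k, l) := q in
      nth_elt i + nth_elt j == nth_elt k + nth_elt l]%SET|.

Definition indexed_energy (A : {fset int}) : nat :=
  #|[set q : 'I_(#|` A|) * 'I_(#|` A|) * 'I_(#|` A|) * 'I_(#|` A|) |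
      let: (i, j, k, l) := q in
      (nth_elt i + nth_elt j == nth_elt k + nth_elt l)
      && (i + j == k + l)%N]%SET|.

(* Main.v *)
(* Take m = floor(n / 2) and a_i = 1 + i + floor(i^2 / m) for 0 <= i < m, a
   strictly increasing sequence in [1, 2m]. There are m^2 pairs but fewer than
   4m possible sums, so Cauchy-Schwarz gives E(A) >= m^3 / 4. For the indexed
   energy, strict convexity is the point: i + j = k + l and
   a_i + a_j = a_k + a_l force |k - i| |l - i| < m, since
   i^2 + j^2 - k^2 - l^2 = 2 (k - i) (l - i). The number of such (i, k, l) is
   at most 4m times the number of (d, e) in [0, m)^2 with d e < m, which by the
   harmonic sum is O(m log m); thus EI(A) = O(m^2 log m). *)
Require Import Defs.
From HB Require Import structures.
From mathcomp Require Import all_boot all_order all_algebra.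
From mathcomp Require Import finmap.
From mathcomp Require Import all_classical all_reals all_analysis.
From mathcomp Require Import zify ring lra.

Set Implicit Arguments.
Unset Strict Implicit.
Unset Printing Implicit Defensive.

Import Order.TTheory GRing.Theory Num.Theory.

Local Open Scope ring_scope.

(** * Counting collisions by Cauchy-Schwarz *)

Lemma sqr_sum_le (U : finType) (r : U -> nat) :
  ((\sum_u r u) ^ 2 <= #|U| * \sum_u r u ^ 2)%N.
Proof.
rewrite -(leq_pmul2l (isT : 0 < 2)%N).
have -> : (2 * (\sum_u r u) ^ 2 = \sum_u \sum_v 2 * (r u * r v))%N.
  rewrite -mulnn big_distrl big_distrr /=; apply: eq_bigr => u _.
  by rewrite big_distrr big_distrr.
have -> : (2 * (#|U| * \sum_u r u ^ 2) = \sum_u \sum_v (r u ^ 2 + r v ^ 2))%N.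
  under [RHS]eq_bigr do rewrite big_split /= sum_nat_const.
  by rewrite big_split /= sum_nat_const -big_distrr /= addnn mul2n.
by apply: leq_sum => u _; apply: leq_sum => v _; apply: nat_Cauchy.
Qed.

(** Fibre sizes [r u] add up to the size of [T], and their squares add up to the number of colliding
    pairs, so Cauchy-Schwarz applies. *)
Lemma card_collisions (T U : finType) (f : T -> U) :
  (#|T| ^ 2 <= #|U| * #|[set p : T * T | f p.1 == f p.2]%SET|)%N.
Proof.
pose r u := (\sum_x (f x == u))%N.
have -> : #|T| = (\sum_u r u)%N.
  rewrite exchange_big -sum1_card; apply: eq_big => // x _.
  by rewrite (bigD1 (f x)) //= eqxx big1 // => u /negbTE; rewrite eq_sym => ->.
suff -> : #|[set p : T * T | f p.1 == f p.2]%SET| = (\sum_u r u ^ 2)%N.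
  exact: sqr_sum_le.
rewrite -sum1_card; under eq_bigl do rewrite inE.
rewrite big_mkcond /= -(pair_bigA _ (fun x y => if f x == f y then 1 else 0)%N) /=.
under [RHS]eq_bigr do rewrite -mulnn big_distrl /=.
rewrite [RHS]exchange_big; apply: eq_bigr => x _ /=.
rewrite (bigD1 (f x)) //= eqxx mul1n [X in _ = (_ + X)%N]big1 ?addn0.
  by apply: eq_bigr => y _; rewrite eq_sym; case: eqP.
by move=> u /negbTE; rewrite eq_sym => ->.
Qed.

(** * Lattice points under a hyperbola *)

Lemma sum_dist_le (m : nat) (i : 'I_m) (g : nat -> nat) :
  (\sum_(k < m) g `|k - i| <= 2 * \sum_(d < m) g d)%N.
Proof.
have lt_dist (k : 'I_m) : (`|k - i| < m)%N by have := ltn_ord k; have := ltn_ord i; lia.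
rewrite (partition_big (fun k => Ordinal (lt_dist k)) predT) //= big_distrr /=.
apply: leq_sum => d _.
rewrite (eq_bigr (fun=> g d)); last by move=> k /eqP <-.
rewrite sum_nat_const leq_mul2r; apply/orP; right.
have le_m2 : (#|[pred b : bool | true]| <= 2)%N by rewrite card_bool.
apply: leq_trans le_m2.
(* At a fixed distance from [i], the side on which [k] lies determines it, so each fibre injects
   into [bool]. *)
rewrite -(@card_in_imset _ _ (fun k : 'I_m => (k <= i)%N)); first exact: max_card.
move=> k l; rewrite !unfold_in => /eqP[/= hk] /eqP[/= hl] hkl.
by apply: val_inj; move: hk hl hkl => /=; lia.
Qed.

(** The axes are included because the quadruples with k = i or l = i must be counted too. *)
Definition hyperbola_count (m : nat) := (\sum_(d < m) \sum_(e < m) (d * e < m))%N.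

Lemma ln_step (R : realType) (d : nat) :
  d.+2%:R^-1 <= ln d.+2%:R - ln d.+1%:R :> R.
Proof.
have h := @le_ln1Dx R (- d.+2%:R^-1).
have d2 : 0 < d.+2%:R :> R by rewrite ltr0n.
have e : 1 + - d.+2%:R^-1 = d.+1%:R / d.+2%:R :> R.
  by move: d2; rewrite -(natr1 d.+1) => d2; field; rewrite lt0r_neq0.
rewrite -lerN2 opprB -ln_div ?posrE // -e; apply: h.
by rewrite ltrN2 invf_lt1 // ltr1n.
Qed.

Lemma harmonic_sum_le (R : realType) (m : nat) :
  \sum_(d < m.+1) d.+1%:R^-1 <= 1 + ln m.+1%:R :> R.
Proof.
elim: m => [|m IH]; first by rewrite big_ord1 ln1 invr1 addr0.
rewrite big_ord_recr /=; apply: le_trans (lerD IH (ln_step R m)) _.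
by rewrite -addrA subrKC.
Qed.

(** Row 0 contributes m and each row d > 0 at most m / d + 1; the harmonic sum turns the total into
    m + m (1 + ln m) + m. *)
Lemma hyperbola_count_le (R : realType) (m : nat) : (0 < m)%N ->
  (hyperbola_count m)%:R <= m%:R * (3 + ln m%:R) :> R.
Proof.
case: m => // m _.
have row (d : nat) : (0 < d)%N ->
    (\sum_(e < m.+1) (d * e < m.+1))%:R <= m.+1%:R * d%:R^-1 + 1 :> R.
  move=> d0; have d0R : 0 < d%:R :> R by rewrite ltr0n.
  have : (\sum_(e < m.+1) (d * e < m.+1) <= (m %/ d).+1)%N.
    rewrite -(big_mkord xpredT (fun e => (d * e < m.+1)%N : nat)).
    under eq_bigr do rewrite ltnS mulnC -leq_divRL // -ltnS.
    rewrite (big_cat_nat (n := minn (m %/ d).+1 m.+1)) //=; last lia.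
    rewrite [X in (_ + X)%N]big_nat_cond [X in (_ + X)%N]big1 ?addn0; last by move=> e; lia.
    apply: (@leq_trans (\sum_(0 <= e < minn (m %/ d).+1 m.+1) 1)%N).
      by apply: leq_sum => e _; case: ltnP.
    by rewrite sum_nat_const_nat; lia.
  rewrite -(ler_nat R) => /le_trans; apply.
  rewrite -natr1 lerD2r ler_pdivlMr // -natrM ler_nat.
  by have := leq_trunc_div m d; lia.
rewrite /hyperbola_count big_ord_recl.
have -> : (\sum_(e < m.+1) (@ord0 m * e < m.+1) = m.+1)%N.
by under eq_bigr do rewrite mul0n ltn0Sn; rewrite sum_nat_const card_ord muln1.
rewrite natrD natr_sum.
(* The right side has one extra nonnegative term, which completes the harmonic sum. *)
have : \sum_(d < m) (\sum_(e < m.+1) (lift ord0 d * e < m.+1))%:R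
    <= \sum_(d < m.+1) (m.+1%:R * d.+1%:R^-1 + 1) :> R.
  rewrite [leRHS]big_ord_recr /=; apply: ler_wpDr; first by rewrite addr_ge0 ?mulr_ge0.
  by apply: ler_sum => d _; apply: row.
rewrite big_split /= -big_distrr /= sumr_const card_ord.
have := harmonic_sum_le R m; have : 0 < m.+1%:R :> R by rewrite ltr0n.
rewrite -(ler_pM2l (x := m.+1%:R)) //.
by set M : R := m.+1%:R; lra.
Qed.

(** * The rounded parabola *)

Definition parabola (m i : nat) : nat := (i + i ^ 2 %/ m)%N.

(** The rounded square is only weakly increasing; the summand [i] supplies strictness. *)
Lemma parabola_homo (m : nat) : {homo parabola m : i j / (i < j)%N}.
Proof.
move=> i j ij; rewrite /parabola -addSn leq_add //.
by rewrite leq_div2r // leq_exp2r // ltnW.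
Qed.

Lemma parabola_lt (m i : nat) : (i < m)%N -> (parabola m i < m.*2.-1)%N.
Proof.
move=> im; have m0 : (0 < m)%N by lia.
have : (i ^ 2 %/ m < m)%N by rewrite ltn_divLR // mulnn ltn_exp2r.
by rewrite /parabola; lia.
Qed.

(* The four roundings change i^2 + j^2 - k^2 - l^2 by less than 2 m. *)
Lemma parabola_rectangle (m i j k l : nat) : (0 < m)%N ->
  (i + j = k + l)%N ->
  (parabola m i + parabola m j = parabola m k + parabola m l)%N ->
  (`|k - i| * `|l - i| < m)%N.
Proof.
move=> m0 ijkl; rewrite /parabola.
have := divn_eq (i ^ 2) m; have := divn_eq (j ^ 2) m.
have := divn_eq (k ^ 2) m; have := divn_eq (l ^ 2) m.
have := ltn_pmod (i ^ 2) m0; have := ltn_pmod (j ^ 2) m0.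
have := ltn_pmod (k ^ 2) m0; have := ltn_pmod (l ^ 2) m0.
move: (_ %/ m)%N (_ %/ m)%N (_ %/ m)%N (_ %/ m)%N => ql qk qj qi.
move: (_ %% m)%N (_ %% m)%N (_ %% m)%N (_ %% m)%N => rl rk rj ri.
move=> hl hk hj hi el ek ej ei e.
(* The linear parts cancel because i + j = k + l, so the quotients balance and only remainders
   survive in the difference of squares. *)
have eq : (qi + qj = qk + ql)%N by lia.
have {eq e} eqm : (qi * m + qj * m = qk * m + ql * m)%N by rewrite -!mulnDl eq.
rewrite -abszM.
have e : (k%:Z - i%:Z) * (l%:Z - i%:Z) * 2 = i%:Z ^+ 2 + j%:Z ^+ 2 - k%:Z ^+ 2 - l%:Z ^+ 2.
  have -> : j%:Z = k%:Z + l%:Z - i%:Z by lia.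
  ring.
by move: e; lia.
Qed.

Definition parabola_seq (m : nat) : seq int :=
  [seq (parabola m i).+1%:Z | i <- iota 0 m].

Definition parabola_set (m : nat) : {fset int} := [fset a in parabola_seq m]%fset.

Lemma parabola_seq_sorted (m : nat) : sorted <%R (parabola_seq m).
Proof.
apply: homo_sorted (iota_ltn_sorted 0 m) => i j ij.
by rewrite ltz_nat ltnS parabola_homo.
Qed.

(** A strictly sorted list is duplicate-free and fixed by sorting. Hence the index in [nth_elt] is
    the parameter of [parabola] itself. *)
Lemma sort_parabola_set (m : nat) :
  sort <=%R (enum_fset (parabola_set m)) = parabola_seq m.
Proof.
have /andP[seq_uniq seq_le] := lt_sorted_is_uniq_le (parabola_seq_sorted m).
rewrite -[RHS](sort_le_id seq_le); apply/perm_sort_leP.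
apply: uniq_perm seq_uniq _; first exact: fset_uniq.
by move=> a; rewrite -[LHS]/(a \in parabola_set m) in_fset.
Qed.

Lemma card_parabola_set (m : nat) : #|` parabola_set m| = m.
Proof. by rewrite -(size_sort <=%R) sort_parabola_set size_map size_iota. Qed.

Lemma nth_parabola_set (m : nat) (i : 'I_(#|` parabola_set m|)) :
  nth_elt i = (parabola m i).+1%:Z.
Proof.
have im : (i < m)%N by rewrite -[X in (_ < X)%N]card_parabola_set.
by rewrite /nth_elt sort_parabola_set (nth_map 0%N) ?size_iota // nth_iota.
Qed.

Lemma nth_parabola_set_sumE (m : nat) (i j k l : 'I_(#|` parabola_set m|)) :
  (nth_elt i + nth_elt j == nth_elt k + nth_elt l) =
  (parabola m i + parabola m j == parabola m k + parabola m l)%N.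
Proof. by rewrite !nth_parabola_set; apply/eqP/eqP; lia. Qed.

Lemma parabola_set_bounds (m : nat) (a : int) :
  a \in parabola_set m -> 1 <= a <= m.*2%:Z.
Proof.
rewrite in_fset => /mapP[i]; rewrite mem_iota => im ->.
by have := @parabola_lt m i im; lia.
Qed.

(** * The two energies *)

Lemma additive_energy_parabola_set (m : nat) : (0 < m)%N ->
  (m ^ 3 <= 4 * additive_energy (parabola_set m))%N.
Proof.
move=> m0; rewrite /additive_energy.
set M := #|` parabola_set m|; have eM : M = m by exact: card_parabola_set.
have ltm (i : 'I_M) : (i < m)%N by rewrite -[X in (_ < X)%N]eM.
have lt4m (p : 'I_M * 'I_M) : (parabola m p.1 + parabola m p.2 < 4 * m)%N.
  by have := parabola_lt (ltm p.1); have := parabola_lt (ltm p.2); lia.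
have := card_collisions (fun p => Ordinal (lt4m p)).
rewrite card_prod !card_ord {1 2}eM.
suff -> : #|[set p : ('I_M * 'I_M) * ('I_M * 'I_M) |
    Ordinal (lt4m p.1) == Ordinal (lt4m p.2)]%SET| =
  #|[set q : 'I_M * 'I_M * 'I_M * 'I_M | let: (i, j, k, l) := q in
      nth_elt i + nth_elt j == nth_elt k + nth_elt l]%SET|.
  (* The collision bound reads m^4 <= 4 m E; a factor m is cancelled. *)
  move=> le_m4; rewrite -(leq_pmul2l m0) -expnS mulnCA mulnA.
  by move: le_m4; rewrite mulnn -expnM.
pose h (q : 'I_M * 'I_M * 'I_M * 'I_M) := let: (i, j, k, l) := q in ((i, j), (k, l)).
have hinj : injective h by move=> [[[? ?] ?] ?] [[[? ?] ?] ?] [-> -> -> ->].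
rewrite -(card_imset _ hinj); apply: eq_card => -[[i j] [k l]].
rewrite inE -val_eqE /=; apply/idP/imsetP => [e|[[[[i' j'] k'] l']]].
  by exists (i, j, k, l) => //; rewrite inE nth_parabola_set_sumE.
by rewrite inE nth_parabola_set_sumE => e [-> -> -> ->].
Qed.

Lemma indexed_energy_parabola_set (m : nat) : (0 < m)%N ->
  (indexed_energy (parabola_set m) <= 4 * m * hyperbola_count m)%N.
Proof.
move=> m0; rewrite /indexed_energy.
set M := #|` parabola_set m|; have eM : M = m by exact: card_parabola_set.
pose h (q : 'I_M * 'I_M * 'I_M * 'I_M) := let: (i, j, k, l) := q in (i, (k, l)).
set S := [set _ | _]%SET.
have hinj : {in S &, injective h}.
  move=> [[[i j] k] l] [[[i' j'] k'] l']; rewrite !inE.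
  move=> /andP[_ /eqP e] /andP[_ /eqP e'] [ei ek el]; subst i' k' l'.
  by congr (_, _, _, _); apply: val_inj => /=; lia.
rewrite -(card_in_imset hinj).
have sub : h @: S \subset [set t : 'I_M * ('I_M * 'I_M) |
    (`|t.2.1 - t.1| * `|t.2.2 - t.1| < m)%N]%SET.
  apply/fintype.subsetP => _ /imsetP[[[[i j] k] l] + ->].
  rewrite !inE nth_parabola_set_sumE /= => /andP[/eqP e /eqP ijkl].
  exact: parabola_rectangle ijkl e.
apply: leq_trans (subset_leq_card sub) _.
rewrite -sum1_card; under eq_bigl do rewrite inE.
rewrite big_mkcond /= -(pair_bigA _ (fun (i : 'I_M) (t : 'I_M * 'I_M) =>
   if `|t.1 - i| * `|t.2 - i| < m then 1 else 0)%N) /=.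
apply: (@leq_trans (\sum_(i < M) 4 * hyperbola_count m)%N); last first.
  by rewrite sum_nat_const card_ord eM; lia.
apply: leq_sum => i _.
rewrite -(pair_bigA _ (fun k l : 'I_M =>
   if `|k - i| * `|l - i| < m then 1 else 0)%N) /=.
(* Passing to the distances |l - i| and then |k - i| costs a factor 2 each, whence the 4. *)
apply: (@leq_trans (\sum_(k < M) 2 * \sum_(e < M) (`|k - i| * e < m))%N).
  apply: leq_sum => k _.
  apply: leq_trans (sum_dist_le i (fun e => (`|k - i| * e < m)%N : nat)).
  by apply: leq_sum => l _; case: ifP.
have := sum_dist_le i (fun d => 2 * \sum_(e < M) (d * e < m))%N.
have -> : hyperbola_count m = (\sum_(d < M) \sum_(e < M) (d * e < m))%N.
  by rewrite eM.
by rewrite -!big_distrr /=; lia.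
Qed.

Lemma ln_ge1 (R : realType) (x : R) : 4 <= x -> 1 <= ln x.
Proof.
move=> x4; have := ln_step R 0; rewrite ln1 subr0.
(* As ln 2 >= 1/2, the two factors 2 already give 1, and x / 4 >= 1 has nonnegative logarithm. *)
have -> : x = 2 * 2 * (x / 4) by field.
rewrite lnM ?posrE ?[ln (2 * 2)]lnM ?posrE; try lra.
by have := @ln_ge0 R (x / 4); lra.
Qed.

Theorem theorem9 (R : realType) :
  exists N : nat, forall n : nat, (N <= n)%N ->
    exists A : {fset int},
      [/\ forall a : int, a \in A -> 1 <= a <= n%:Z,
          n%:R / 3 <= #|` A|%:R :> R,
          1 / 6 * #|` A|%:R ^+ 3 <= (additive_energy A)%:R :> R &
          (indexed_energy A)%:R
            <= 2000 * #|` A|%:R ^+ 2 * ln (#|` A|%:R) ^+ 2 :> R].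
Proof.
(* From n >= 8 follows m >= 4, hence ln m >= 1, and also n <= 2 m + 1 <= 3 m. *)
exists 8%N => n n8; exists (parabola_set n./2).
have m4 : (4 <= n./2)%N by lia.
have m0 : (0 < n./2)%N by lia.
have nm : (n <= 3 * n./2)%N by lia.
have mn : (n./2.*2 <= n)%N by lia.
rewrite card_parabola_set; move: n./2 m4 m0 nm mn => m m4 m0 nm mn; split.
- by move=> a /parabola_set_bounds; lia.
- by rewrite ler_pdivrMr // -natrM ler_nat; lia.
- have := additive_energy_parabola_set m0.
  by rewrite -(ler_nat R) natrM natrX; have : 0 <= (additive_energy (parabola_set m))%:R :> R by []; lra.
have := indexed_energy_parabola_set m0; rewrite -(ler_nat R) !natrM => /le_trans; apply.
have := hyperbola_count_le R m0; move: (hyperbola_count m)%:R => H leH.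
have L1 : 1 <= ln m%:R :> R by apply: ln_ge1; rewrite ler_nat.
move: leH L1; set L := ln _; set x : R := m%:R => leH L1.
have x0 : 0 <= x by [].
have : 4 * x * H <= 4 * x * (x * (3 + L)) by apply: ler_wpM2l => //; lra.
move/le_trans; apply.
(* Since L >= 1, 4 (3 + L) <= 16 L^2, well below 2000 L^2. *)
have -> : 4 * x * (x * (3 + L)) = x ^+ 2 * (4 * (3 + L)) by ring.
have -> : 2000 * x ^+ 2 * L ^+ 2 = x ^+ 2 * (2000 * L ^+ 2) by ring.
by apply: ler_wpM2l; [rewrite sqr_ge0 | nra].
Qed.
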